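(* Let $\kappa$ and $\lambda$ be cardinals with $\kappa>\lambda>\mathrm{cf}(\kappa)>\omega$ and $\mathrm{cf}(\lambda)>\omega$. Let $\{\kappa_\alpha:\alpha<\mathrm{cf}(\kappa)\}$ be a family of cardinals such that $\lambda\leq\kappa_0$, the family is strictly increasing in $\alpha$, and $\sup\{\kappa_\alpha:\alpha<\mathrm{cf}(\kappa)\}=\kappa$. Then $\kappa$ is a caliber for $C_p(L(\lambda,\kappa_\alpha))$ for every $\alpha<\mathrm{cf}(\kappa)$, but $\kappa$ is not a caliber for $C_p\big(\bigoplus_{\alpha<\mathrm{cf}(\kappa)}L(\lambda,\kappa_\alpha)\big)$.
   Context: For cardinals $\omega\le\lambda\le\theta$, the one-point $\lambda$-Lindel\''of extension $L(\lambda,\theta)$ of the discrete space of size $\theta$ is the set $\theta\cup\{\theta\}$ whose open sets are all subsets of $\theta$ together with all sets $U\subseteq\theta\cup\{\theta\}$ such that $\theta\in U$ and $|(\theta\cup\{\theta\})\setminus U|<\lambda$. $\bigoplus$ denotes the topological sum (disjoint union). For a Tychonoff space $X$, $C_p(X)$ is the set of continuous functions $X\to\mathbb{R}$ with the topology of pointwise convergence (the subspace topology from $\mathbb{R}^X$). An infinite cardinal $\kappa$ is a caliber for a space $Z$ if for every set $I$ with $|I|=\kappa$ and every indexed family $\{U_\alpha:\alpha\in I\}$ of nonempty open subsets of $Z$ there is $J\subseteq I$ with $|J|=\kappa$ and $\bigcap_{\alpha\in J}U_\alpha\neq\emptyset$. *)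

(* Defs.v *)
From HB Require Import structures.
From mathcomp Require Import all_boot all_order all_algebra.
From mathcomp Require Import all_classical wochoice all_reals topology.
From mathcomp Require Import zify.
Import numFieldTopology.Exports.

Set Implicit Arguments.
Unset Strict Implicit.
Unset Printing Implicit Defensive.

Local Open Scope classical_set_scope.
Local Open Scope card_scope.

Definition card_lt T U (A : set T) (B : set U) := (A #<= B) && (A #!= B).
Notation "A '#<' B" := (card_lt A B) (at level 79, format "A  '#<'  B")
  : card_scope.

Lemma card_ltP T U (A : set T) (B : set U) :
  (A #< B) <-> (A #<= B) /\ ~~ (B #<= A).
Proof.
rewrite /card_lt; split=> [/andP[AB nAB]|[AB nBA]].
  by split=> //; apply: contra nAB => BA; rewrite card_eq_le AB.
by rewrite AB /=; apply: contra nBA; rewrite card_eq_le => /andP[].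
Qed.

Lemma card_le_lt_trans T U V (A : set T) (B : set U) (C : set V) :
  A #<= B -> B #< C -> A #< C.
Proof.
move=> AB /card_ltP[BC nCB]; apply/card_ltP; split.
  exact: card_le_trans BC.
by apply: contra nCB => CA; exact: card_le_trans AB.
Qed.

Lemma card_le_rel T U (A : set T) (B : set U) (G : T -> U -> Prop) :
  (forall a, A a -> exists2 b, B b & G a b) ->
  (forall a a' b, A a -> A a' -> G a b -> G a' b -> a = a') ->
  A #<= B.
Proof.
move=> Gtot Ginj.
have ex (x : A) : exists y : B, G (val x) (val y).
  have [b Bb Gb] := Gtot _ (set_valP x).
  by exists (SigSub (mem_set Bb)).
have [f Hf] := choice ex.
apply/card_leP/injfunPex; exists f => // x y _ _ fxy.
apply/val_inj; apply: (Ginj _ _ (val (f x))) => //; do 1?[exact: set_valP].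
by rewrite fxy.
Qed.

Lemma card_leE T U (A : set T) (B : set U) : A #<= B ->
  exists G : T -> U -> Prop,
    (forall a, A a -> exists2 b, B b & G a b) /\
    (forall a a' b, A a -> A a' -> G a b -> G a' b -> a = a').
Proof.
move=> /card_leP/injfunPex[f _ finj].
exists (fun a b => exists x : A, val x = a /\ val (f x) = b); split.
  move=> a Aa; exists (val (f (SigSub (mem_set Aa)))); first exact: set_valP.
  by exists (SigSub (mem_set Aa)).
move=> a a' _ _ _ [x [<- <-]] [y [<- /val_inj fxy]].
by rewrite (finj y x) ?inE.
Qed.

Lemma card_le_total T U (A : set T) (B : set U) : (A #<= B) || (B #<= A).
Proof.
pose P (G : set (T * U)) := [/\ (forall p, G p -> A p.1 /\ B p.2),
  (forall p q, G p -> G q -> p.1 = q.1 -> p = q) &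
  (forall p q, G p -> G q -> p.2 = q.2 -> p = q)].
have [F FP Ftot|G [[GAB G1 G2] Gmax]] := @Zorn_bigcup _ P.
  have pair p q : (\bigcup_(X in F) X) p -> (\bigcup_(X in F) X) q ->
      exists2 X, F X & X p /\ X q.
    move=> [X FX Xp] [Y FY Yq].
    by have [XY|YX] := Ftot _ _ FX FY; [exists Y|exists X] => //; split=> //;
      [exact: XY|exact: YX].
  split.
  - by move=> p [X /FP[XAB _ _] /XAB].
  - by move=> p q Up Uq; have [X /FP[_ X1 _] []] := pair _ _ Up Uq; exact: X1.
  - by move=> p q Up Uq; have [X /FP[_ _ X2] []] := pair _ _ Up Uq; exact: X2.
have [Atot|/existsNP[a0 /not_implyP[Aa /forallNP na]]] :=
    pselect (forall a, A a -> exists b, G (a, b)).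
  apply/orP; left; apply: (@card_le_rel _ _ _ _ (fun a b => G (a, b))).
    by move=> a /Atot[b Gab]; exists b => //; have [] := GAB _ Gab.
  by move=> a a' b _ _ Ga Ga'; have [] := G2 _ _ Ga Ga' erefl.
have [Btot|/existsNP[b0 /not_implyP[Bb /forallNP nb]]] :=
    pselect (forall b, B b -> exists a, G (a, b)).
  apply/orP; right; apply: (@card_le_rel _ _ _ _ (fun b a => G (a, b))).
    by move=> b /Btot[a Gab]; exists a => //; have [] := GAB _ Gab.
  by move=> b b' a _ _ Gb Gb'; have [] := G1 _ _ Gb Gb' erefl.
exfalso; apply: (Gmax (G `|` [set (a0, b0)])).
  split; first exact: subsetUl.
  by move=> /(_ (a0, b0))/=-/(_ (or_intror erefl)); exact: na.
split.
- by move=> p [/GAB//|->].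
- move=> [a1 b1] [a2 b2] [Gp|[-> ->]] [Gq|[-> ->]] //=; first exact: (G1 _ _ Gp Gq).
    by move=> aa; move: Gp; rewrite aa => /na.
  by move=> aa; move: Gq; rewrite -aa => /na.
- move=> [a1 b1] [a2 b2] [Gp|[-> ->]] [Gq|[-> ->]] //=; first exact: (G2 _ _ Gp Gq).
    by move=> bb; move: Gp; rewrite bb => /nb.
  by move=> bb; move: Gq; rewrite -bb => /nb.
Qed.

Lemma infinite_seq T (A : set T) : infinite_set A ->
  exists2 e : nat -> T, injective e & forall n, A (e n).
Proof.
move=> /infiniteP/card_leP/injfunPex[f _ finj].
exists (fun n => val (f (SigSub (mem_set (I : [set: nat] n))))).
  by move=> n m /val_inj/finj; rewrite !inE => /(_ I I)[].
by move=> n; exact: set_valP.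
Qed.

Lemma card_le_double T (C : set T) : infinite_set C ->
  C `*` [set: bool] #<= C.
Proof.
move=> Cinf.
pose ran (G : set ((T * bool) * T)) := [set c | exists p, G (p, c)].
pose P (G : set ((T * bool) * T)) := [/\ ran G `<=` C,
  (forall p x y, G (p, x) -> G (p, y) -> x = y),
  (forall p q x, G (p, x) -> G (q, x) -> p = q) &
  (forall c b, ran G c <-> exists x, G ((c, b), x))].
have [F FP Ftot|G [[GC G1 G2 GD] Gmax]] := @Zorn_bigcup _ P.
  have pair p q : (\bigcup_(X in F) X) p -> (\bigcup_(X in F) X) q ->
      exists2 X, F X & X p /\ X q.
    move=> [X FX Xp] [Y FY Yq].
    by have [XY|YX] := Ftot _ _ FX FY; [exists Y|exists X] => //; split=> //;
      [exact: XY|exact: YX].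
  split.
  - by move=> c [p [X /FP[XC _ _ _] Xpc]]; apply: XC; exists p.
  - move=> p x y Up Uq; have [X /FP[_ X1 _ _] []] := pair _ _ Up Uq; exact: X1.
  - move=> p q x Up Uq; have [X /FP[_ _ X2 _] []] := pair _ _ Up Uq; exact: X2.
  - move=> c b; split=> [[p [X FX Xpc]]|[x [X FX Xcx]]].
      have [_ _ _ XD] := FP _ FX.
      have /XD-/(_ b)[x Xx] : ran X c by exists p.
      by exists x, X.
    have [_ _ _ XD] := FP _ FX.
    have /(XD c b)[p Xp] : exists x, X ((c, b), x) by exists x.
    by exists p, X.
pose D := ran G.
have DD : D `*` [set: bool] #<= D.
  apply: (@card_le_rel _ _ _ _ (fun p x => G (p, x))).
    move=> [c b] [/= /GD-/(_ b)[x Gx] _].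
    by exists x => //; exists (c, b).
  by move=> p q x _ _; exact: G2.
have CDfin : finite_set (C `\` D).
  apply: contrapT => /infinite_seq[e einj eCD].
  pose H := G `|` [set q | exists n (b : bool),
                     q = ((e n, b), e (2 * n + b)%N)].
  have eb n (b : bool) n' (b' : bool) : e (2 * n + b)%N = e (2 * n' + b')%N -> (n, b) = (n', b').
    by move/einj; case: b; case: b' => /= ?; solve [exfalso; lia | congr pair; lia].
  have nD n : ~ D (e n) by have [] := eCD n.
  have nG n b x : ~ G ((e n, b), x).
    by move=> Gx; apply: (nD n); apply/(GD _ b); exists x.
  have ranH c : ran H c <-> D c \/ exists n, c = e n.
    split=> [[p [Gp|[n [b [_ ->]]]]]|[[p Gp]|[n ->]]].
    - by left; exists p.
    - by right; exists (2 * n + b)%N.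
    - by exists p; left.
    - exists (e n./2, odd n); right; exists n./2, (odd n).
      by congr (_, e _); rewrite -[LHS]odd_double_half mul2n addnC.
  apply: (Gmax H).
    split; first exact: subsetUl.
    move=> /(_ ((e 0%N, true), e 1%N))/=-HG.
    by apply: (@nG 0%N true (e 1%N)); apply: HG; right; exists 0%N, true.
  split.
  - by move=> c /ranH[/GC//|[n ->]]; have [] := eCD n.
  - move=> p x y [Gx|[n [b [-> ->]]]] [Gy|[m [b' [pE ->]]]].
    + exact: G1 Gx Gy.
    + by move: Gx; rewrite pE => /nG.
    + by move: Gy => /nG.
    + by case: pE => /einj -> ->.
  - move=> p q x [Gx|[n [b [-> ->]]]] [Gy|[m [b' [qE xE]]]].
    + exact: G2 Gx Gy.
    + by case: (nD (2 * m + b')%N); rewrite -xE; exists p.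
    + by case: (nD (2 * n + b)%N); exists q.
    + by rewrite qE; have [-> ->] := eb _ _ _ _ xE.
  - move=> c b; split=> [/ranH[/GD-/(_ b)[x Gx]|[n ->]]|[x [Gx|]]].
    + by exists x; left.
    + by exists (e (2 * n + b)%N); right; exists n, b.
    + by apply/ranH; left; apply/(GD _ b); exists x.
    + by move=> [n [b' [-> _ _]]]; apply/ranH; right; exists n.
have Dinf : infinite_set D.
  move=> Dfin; apply: Cinf.
  apply: (@sub_finite_set _ _ ((C `\` D) `|` D)); last by rewrite finite_setU.
  by move=> x Cx; have [Dx|nDx] := pselect (D x); [right|left].
have CD : C #<= D.
  apply: card_le_trans DD.
  have CDD : C `\` D #<= D.
    have /orP[//|DCD] := card_le_total (C `\` D) D.
    by case: Dinf; exact: card_le_finite DCD CDfin.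
  have [K [Ktot Kinj]] := card_leE CDD.
  apply: (@card_le_rel _ _ _ _ (fun c p =>
    D c /\ p = (c, true) \/ ~ D c /\ K c p.1 /\ p.2 = false)).
    move=> c Cc; have [Dc|nDc] := pselect (D c).
      by exists (c, true) => //; left.
    by have [//|d Dd Kcd] := Ktot c; exists (d, false) => //; right.
  move=> c c' [d b] Cc Cc' /= [[Dc [-> ->]]|[nDc [Kc ->]]] [[Dc' []]|[nDc' [Kc' ]]] //.
  by move=> _; exact: Kinj Kc Kc'.
apply: (@card_le_trans _ _ _ (D `*` [set: bool])); last first.
  by apply: card_le_trans DD _; exact: subset_card_le.
have [K [Ktot Kinj]] := card_leE CD.
apply: (@card_le_rel _ _ _ _ (fun p q => K p.1 q.1 /\ p.2 = q.2)).
  by move=> [c b] [/= /Ktot[d Dd Kcd] _]; exists (d, b).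
move=> [c b] [c' b'] [d b''] [/= Cc _] [/= Cc' _] [Kc ->] [Kc' ->].
by rewrite (Kinj _ _ _ Cc Cc' Kc Kc').
Qed.

Lemma card_le_setU T (A B : set T) : infinite_set B -> A #<= B ->
  A `|` B #<= B.
Proof.
move=> Binf AB; apply: card_le_trans (card_le_double Binf).
have [K [Ktot Kinj]] := card_leE AB.
apply: (@card_le_rel _ _ _ _ (fun c p =>
  B c /\ p = (c, true) \/ ~ B c /\ K c p.1 /\ p.2 = false)).
  move=> c ABc; have [Bc|nBc] := pselect (B c).
    by exists (c, true) => //; left.
  case: ABc => // /Ktot[d Bd Kcd]; exists (d, false) => //; by right.
move=> c c' [d b] Cc Cc' /= [[Bc [-> ->]]|[nBc [Kc ->]]].
  by move=> [[_ []]|[_ []]].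
move=> [[_ []]//|[nBc' [Kc' _]]].
by apply: Kinj Kc Kc'; [case: Cc|case: Cc'].
Qed.

Lemma card_lt_setU T U (A B : set T) (L : set U) : infinite_set L ->
  A #< L -> B #< L -> A `|` B #< L.
Proof.
move=> Linf; wlog AB : A B / A #<= B => [wl AL BL|AL BL].
  have /orP[AB|BA] := card_le_total A B; first exact: wl.
  by rewrite setUC; exact: wl.
have [Bfin|Binf] := pselect (finite_set B); last first.
  exact: card_le_lt_trans (card_le_setU Binf AB) BL.
have ABfin : finite_set (A `|` B).
  by rewrite finite_setU; split=> //; exact: card_le_finite AB Bfin.
apply/card_ltP; split; last first.
  by apply/negP => LAB; apply: Linf; exact: card_le_finite LAB ABfin.
have /orP[//|LAB] := card_le_total (A `|` B) L.
by case: Linf; exact: card_le_finite LAB ABfin.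
Qed.

(** Cardinals are initial ordinals: elements of the carrier stand for the
    smaller ordinals. Unique minima of nonempty subsets ([well_order]) make
    [ordle] a reflexive total order. *)
Record cardinal := Cardinal {
  cardinal_sort :> choiceType ;
  ordle : rel cardinal_sort ;
  ordle_wo : well_order ordle ;
  ordle_initial : forall x,
    [set y | ordle y x /\ y <> x] #< [set: cardinal_sort] }.

Record infinite_cardinal := InfiniteCardinal {
  infinite_cardinal_sort :> cardinal ;
  infinite_cardinalP : infinite_set [set: infinite_cardinal_sort] }.

Definition ordlt (kappa : cardinal) (x y : kappa) := ordle x y /\ x <> y.

Lemma leq_well_order : well_order leq.
Proof.
apply: antisymmetric_well_order; first exact: anti_leq.
move=> A [n An]; case: (ex_minnP (ex_intro _ n An)) => m Am mmin.
by exists m; split=> // k; exact: mmin.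
Qed.

Lemma leq_initial n : [set m | (m <= n)%N /\ m <> n] #< [set: nat].
Proof.
have fin : finite_set [set m | (m <= n)%N /\ m <> n].
  apply: (@sub_finite_set _ _ `I_n) => // m [/= mn /eqP mDn].
  by rewrite ltn_neqAle mDn.
apply/card_ltP; split; first exact: card_leT.
by apply/negP => /card_le_finite/(_ fin); exact: infinite_nat.
Qed.

Definition omega := Cardinal leq_well_order leq_initial.

Definition cofinal (kappa : cardinal) (A : set kappa) :=
  forall x, exists2 a, A a & ordle x a.

(** This determines [mu] up to order isomorphism, so that an index ranging over
    the ordinals below cf(kappa) is an element of such a [mu]. *)
Definition is_cofinality (mu kappa : cardinal) :=
  (exists2 A : set kappa, cofinal A & A #= [set: mu]) /\
  (forall A : set kappa, cofinal A -> [set: mu] #<= A).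

Definition is_cardinal_sup (I : Type) (nu : I -> cardinal) (kappa : cardinal) :=
  (forall i, [set: nu i] #<= [set: kappa]) /\
  (forall rho : cardinal,
    (forall i, [set: nu i] #<= [set: rho]) -> [set: kappa] #<= [set: rho]).

(** [Some x] are the points of the discrete space, [None] is the added point;
    [lam] must be infinite for the open sets to be closed under intersection. *)
Definition lindelof_ext (lam : infinite_cardinal) (theta : cardinal) : Type :=
  option theta.

Section lindelof_ext.
Variables (lam : infinite_cardinal) (theta : cardinal).
Local Notation L := (lindelof_ext lam theta).

Definition lindelof_open : set_system L :=
  [set U | ~ U None \/ (U None /\ ~` U #< [set: lam])].

Let lindelof_openT : lindelof_open [set: L].
Proof.
right; split=> //; rewrite setCT; apply/card_ltP; split=> //.
by apply/negP => /card_le_finite-/(_ (finite_set0 _)); exact: infinite_cardinalP.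
Qed.

Let lindelof_openI : setI_closed lindelof_open.
Proof.
move=> U V [nU|[UN Ul]] [nV|[VN Vl]]; [by left => -[]..|right].
by split=> //; rewrite setCI; apply: card_lt_setU => //; exact: infinite_cardinalP.
Qed.

Let lindelof_open_bigU (I : Type) (f : I -> set L) :
  (forall i, lindelof_open (f i)) -> lindelof_open (\bigcup_i f i).
Proof.
move=> fo; have [[i _ fi]|] := pselect ((\bigcup_i f i) None); last by left.
right; split; first by exists i.
have [//|[_]] := fo i; apply: card_le_lt_trans; apply: subset_card_le.
by apply: subsetC => x fx; exists i.
Qed.

HB.instance Definition _ := Choice.on L.
HB.instance Definition _ := isOpenTopological.Build L
  lindelof_openT lindelof_openI lindelof_open_bigU.

Lemma lindelof_openE : @open L = lindelof_open.
Proof. by []. Qed.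

End lindelof_ext.

Definition Cp (R : realType) (X : topologicalType) : Type := continuousType X R.

HB.instance Definition _ (R : realType) (X : topologicalType) :=
  Topological.copy (Cp R X)
    (initial_topology ((fun f => f) : continuousType X R -> {ptws X -> R})).

Definition caliber (kappa : cardinal) (Z : topologicalType) :=
  forall (I : Type) (U : I -> set Z),
    [set: I] #= [set: kappa] ->
    (forall i, open (U i) /\ U i !=set0) ->
    exists2 J : set I, J #= [set: kappa] & \bigcap_(i in J) U i !=set0.

(* Main.v *)
From HB Require Import structures.
Require Import Defs.
From mathcomp Require Import all_boot all_order all_algebra.
From mathcomp Require Import all_classical wochoice all_reals topology.
From mathcomp Require Import lra.
Import numFieldTopology.Exports.
Import Order.TTheory GRing.Theory Num.Theory.

(** The difference lies in the number of points. Each summand has fewer than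
    [kappa], so that [kappa] finite conditions on a function must repeat; the
    sum has [kappa], so that each may carry a condition of its own.

    For a single space, every nonempty open set of [Cp] contains the set of
    continuous functions with prescribed rational values at finitely many
    points. There are only [kappa_ a] such prescriptions, and [kappa_ a] is
    below [kappa]. So of [kappa] open sets, for every [b] at least [kappa_ b]
    contain the same prescribed set, although [kappa] many need not, as [kappa]
    is singular ([large_fibre]). This gives one finite prescription for each
    [b] below cf(kappa). Since cf(kappa) is regular ([cofinality_regular]) and
    uncountable, cf(kappa) many of these are compatible
    ([compatible_subfamily], a form of the Delta-system lemma). Together they
    concern at most cf(kappa) points, which is less than [lam]; and a function
    that is constant off fewer than [lam] points is continuous at the added
    point, where the constant is its value ([lindelof_continuous]). This
    function lies in [kappa] of the open sets, because cf(kappa) many indices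
    [b] are unbounded and the [kappa_ b] have supremum [kappa].

    For the sum, index open sets by the isolated points, of which there are
    [kappa]: the functions near 2 at that point and near 0 at the added point
    of its summand. On each summand, a continuous function is away from its
    value at the added point at fewer than [lam] points
    ([lindelof_continuous_far]). It thus belongs to at most cf(kappa) * lam =
    lam of the open sets, and [lam < kappa].

    The cardinal arithmetic behind both counts is that an infinite set is
    equinumerous with its square ([card_le_square]), hence that a union of at
    most [C] sets of size at most [C] has size at most [C]
    ([card_le_bigcup]). *)

Set Implicit Arguments.
Unset Strict Implicit.
Unset Printing Implicit Defensive.

Local Open Scope classical_set_scope.
Local Open Scope card_scope.

(** * Arithmetic of infinite cardinalities *)

Lemma card_le_fun T U (A : set T) (B : set U) (f : T -> U) :
  (forall a, A a -> B (f a)) ->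
  (forall a a', A a -> A a' -> f a = f a' -> a = a') ->
  A #<= B.
Proof.
move=> fAB finj; apply: (@card_le_rel _ _ _ _ (fun a b => f a = b)).
  by move=> a Aa; exists (f a) => //; exact: fAB.
by move=> a a' b Aa Aa' <- /esym; exact: finj.
Qed.

Lemma card_leT_fun T U (B : set U) : [set: T] #<= B ->
  exists2 f : T -> U, (forall a, B (f a)) & injective f.
Proof.
move=> /card_leE[G [Gtot Ginj]].
have [|f fP] := @choice _ _ (fun a b => B b /\ G a b).
  by move=> a; have [//|b] := Gtot a; exists b.
exists f => [a|a a' faa']; first by case: (fP a).
by apply: (Ginj _ _ (f a)) => //; [case: (fP a)|rewrite faa'; case: (fP a')].
Qed.

Lemma card_ltNge T U (A : set T) (B : set U) : (A #< B) <-> ~ (B #<= A).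
Proof.
split=> [/card_ltP[_ /negP]//|nBA]; apply/card_ltP; split; last exact/negP.
by have /orP[//|/nBA] := card_le_total A B.
Qed.

Lemma card_lt_le_trans T U V (A : set T) (B : set U) (C : set V) :
  A #< B -> B #<= C -> A #< C.
Proof.
move=> /card_ltNge nBA BC; apply/card_ltNge => CA.
by apply: nBA; exact: card_le_trans CA.
Qed.

Lemma card_ltW T U (A : set T) (B : set U) : A #< B -> A #<= B.
Proof. by case/card_ltP. Qed.

Lemma infinite_card_le T U (A : set T) (B : set U) :
  infinite_set A -> A #<= B -> infinite_set B.
Proof. by move=> Ainf AB Bfin; apply: Ainf; exact: card_le_finite Bfin. Qed.

(** Unlike [Zorn_bigcup], only nonempty chains need a union in [P]. The empty
    chain is taken care of by [G0], which is joined to every member. *)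
Lemma Zorn_bigcup_above T (P : set (set T)) (G0 : set T) :
  P G0 ->
  (forall F : set (set T), F !=set0 -> F `<=` P -> total_on F subset ->
    P (\bigcup_(X in F) X)) ->
  exists G, [/\ P G, G0 `<=` G & forall B, G `<` B -> ~ P B].
Proof.
move=> PG0 Pcup.
have [F FQ Ftot|A [QA Amax]] := @Zorn_bigcup _ [set X | P (G0 `|` X)].
  have [->|/set0P[X0 FX0]] := eqVneq F set0.
    by rewrite /= bigcup_set0 setU0.
  rewrite /= (_ : _ `|` _ = \bigcup_(X in [set G0 `|` X | X in F]) X);
    last first.
  - apply/seteqP; split=> [x [G0x|[X FX Xx]]|x [_ [X FX <-] [G0x|Xx]]].
    + by exists (G0 `|` X0); [exists X0|left].
    + by exists (G0 `|` X); [exists X|right].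
    + by left.
    + by right; exists X.
  - apply: Pcup; [by exists (G0 `|` X0), X0|by move=> _ [X /FQ ? <-]|].
    move=> _ _ [X FX <-] [Y FY <-].
    by have [XY|YX] := Ftot _ _ FX FY; [left|right]; exact: setUS.
exists (G0 `|` A); split=> [//|x ?|B [AB nBA] PB]; first by left.
have AB' : A `<=` B by apply: subset_trans AB; exact: subsetUr.
apply: (Amax B).
  split=> // BA; apply: nBA; apply: subset_trans BA _; exact: subsetUr.
rewrite /= (_ : G0 `|` B = B) //; apply/setUidPr.
by apply: subset_trans AB; exact: subsetUl.
Qed.

Lemma card_leX T T' U U' (A : set T) (A' : set T') (B : set U) (B' : set U') :
  A #<= A' -> B #<= B' -> A `*` B #<= A' `*` B'.
Proof.
move=> /card_leE[G [Gtot Ginj]] /card_leE[H [Htot Hinj]].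
apply: (@card_le_rel _ _ _ _ (fun p q => G p.1 q.1 /\ H p.2 q.2)).
  move=> [a b] [/= /Gtot[a' ? ?] /Htot[b' ? ?]].
  by exists (a', b').
move=> [a b] [c d] [x y] [/= Aa Bb] [/= Ac Bd] [Ga Hb] [Gc Hd].
by rewrite (Ginj a c x) // (Hinj b d y).
Qed.

(** Zorn on the injective relations from [D `*` D] to [D], with [D `<=` A]
    infinite. If a maximal [D] were smaller than [A], its complement in [A]
    would contain a copy [E] of [D], and there would be room in [E] for the
    pairs of [E `|` D] that are not pairs of [D]. *)
Lemma card_le_square T (A : set T) : infinite_set A -> A `*` A #<= A.
Proof.
move=> Ainf.
(* [D] is recovered from the relation as the set of the [c] whose diagonal pair
   is related to something, so the relation alone is ordered by inclusion. *)
pose dom (G : set ((T * T) * T)) := [set c | exists x, G ((c, c), x)].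
pose P (G : set ((T * T) * T)) := [/\ dom G `<=` A,
  (forall p x, G (p, x) -> dom G x),
  (forall p q x, G (p, x) -> G (q, x) -> p = q) &
  (forall c d, (dom G c /\ dom G d) <-> exists x, G ((c, d), x))].
have [e einj eA] := infinite_seq Ainf.
(* Starting from a copy of [nat * nat -> nat] keeps [D] infinite, which excludes
   the maximal relation on a single point. *)
pose G0 : set ((T * T) * T) :=
  [set q | exists n m, q = ((e n, e m), e (pickle (n, m)))].
have domG0 n : dom G0 (e n) by eexists; exists n, n.
have PG0 : P G0.
  split.
  - by move=> c [x [n [m [-> _ _]]]]; exact: eA.
  - by move=> p x [n [m [_ ->]]]; exact: domG0.
  - move=> p q x [n [m [-> ->]]] [n' [m' [-> /einj]]].
    by move=> /(pcan_inj pickleK)[-> ->].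
  - move=> c d; split=> [[[x [n [m [-> _ _]]]] [y [n' [m' [-> _ _]]]]]|].
      by eexists; exists n, n'.
    by move=> [x [n [m [-> -> _]]]].
have [F F0 FP Ftot|G [[GA Gran G2 GD] G0G Gmax]] := Zorn_bigcup_above PG0.
  have pair p q : (\bigcup_(X in F) X) p -> (\bigcup_(X in F) X) q ->
      exists2 X, F X & X p /\ X q.
    move=> [X FX Xp] [Y FY Yq].
    by have [XY|YX] := Ftot _ _ FX FY; [exists Y|exists X] => //; split=> //;
      [exact: XY|exact: YX].
  split.
  - by move=> c [x [X /FP[XA _ _ _] Xc]]; apply: XA; exists x.
  - move=> p x [X FX Xpx]; have [_ Xran _ _] := FP _ FX.
    by have [y Xy] := Xran _ _ Xpx; exists y, X.
  - by move=> p q x Up Uq; have [X /FP[_ _ X2 _] []] := pair _ _ Up Uq;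
      exact: X2.
  - move=> c d; split=> [[[x Ux] [y Uy]]|[x [X FX Xx]]].
      have [X FX [Xx Xy]] := pair _ _ Ux Uy.
      have [_ _ _ XD] := FP _ FX.
      have [|z Xz] := (XD c d).1; first by split; [exists x|exists y].
      by exists z, X.
    have [_ _ _ XD] := FP _ FX.
    have [|[y Xy] [z Xz]] := (XD c d).2; first by exists x.
    by split; [exists y, X|exists z, X].
pose D := dom G.
have DD : D `*` D #<= D.
  apply: (@card_le_rel _ _ _ _ (fun p x => G (p, x))).
    move=> [c d] [/= Dc Dd]; have [x Gx] := (GD c d).1 (conj Dc Dd).
    by exists x => //; exact: Gran Gx.
  by move=> p q x _ _; exact: G2.
have Dinf : infinite_set D.
  apply: (@infinite_card_le _ _ [set: nat]); first exact: infinite_nat.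
  apply: (@card_le_fun _ _ _ _ e) => [n _|n m _ _]; last exact: einj.
  by have [x G0x] := domG0 n; exists x; exact: G0G.
have [AD|/card_ltNge DA] := pselect (A #<= D).
  apply: card_le_trans (card_leX AD AD) _.
  by apply: card_le_trans DD _; exact: subset_card_le.
exfalso.
have DE : D #<= A `\` D.
  have /orP[//|ED] := card_le_total D (A `\` D).
  have /card_ltNge[] := DA; apply: card_le_trans (card_le_setU Dinf ED).
  by apply: subset_card_le => x Ax; have [Dx|Dx] := pselect (D x);
    [right|left].
have [d0 Dd0] := infinite_setN0 Dinf.
have /card_leE[K [Ktot Kinj]] := DE.
have [x|f fP] := @choice _ _ (fun x y => D x -> (A `\` D) y /\ K x y).
  by have [/Ktot[y]|] := pselect (D x); [exists y|exists x].
have finj x y : D x -> D y -> f x = f y -> x = y.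
  move=> Dx Dy fxy; apply: (Kinj _ _ (f x)) => //; first by case: (fP _ Dx).
  by rewrite fxy; case: (fP _ Dy).
pose E := f @` D.
have EnD x : E x -> A x /\ ~ D x by move=> [y /fP[[]] ? ? _ <-].
have cDE : D #<= E.
  by apply: (@card_le_fun _ _ _ _ f) => // x Dx; exists x.
have cED : E #<= D by exact: card_image_le.
have cDU : E `|` D #<= D by exact: card_le_setU.
have /card_leE[H [Htot Hinj]] : (E `|` D) `*` (E `|` D) #<= E.
  by apply: card_le_trans (card_leX cDU cDU) _; exact: card_le_trans DD _.
(* Values of new pairs lie in [E], values of old pairs in [D]: no clash. *)
pose G' := G `|` [set q | [/\ (E `|` D) q.1.1, (E `|` D) q.1.2,
  ~ (D q.1.1 /\ D q.1.2), E q.2 & H q.1 q.2]].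
have domG' c : dom G' c <-> (E `|` D) c.
  split=> [[x [Gx|[]//]]|]; first by right; exists x.
  move=> [Ec|[x Gx]]; last by exists x; left.
  have [//|x Ex Hx] := Htot (c, c); first by split; left.
  by exists x; right; split=> //=; [left|left|case=> /(EnD _ Ec).2].
have nGE p x : G (p, x) -> ~ E x by move=> /Gran Dx /EnD[].
apply: (Gmax G').
  split; first exact: subsetUl.
  have [x0 Ex0] : exists x, E x by exists (f d0), d0.
  have [x G'x] := (domG' x0).2 (or_introl Ex0).
  by move=> /(_ _ G'x) Gx; have [_] := EnD _ Ex0; apply; exists x.
split.
- by move=> c /domG'[/EnD[]|/GA].
- move=> p x [/Gran Dx|[_ _ _ Ex _]]; apply/domG'; [by right|by left].
- move=> [a b] [c d] x [Gp|/= [pa pb _ Ex Hp]] [Gq|/= [qc qd _ Ex' Hq]].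
  + exact: G2 Gp Gq.
  + by case: (nGE _ _ Gp).
  + by case: (nGE _ _ Gq).
  + exact: Hinj Hp Hq.
- move=> c d; split=> [[/domG' UDc /domG' UDd]|[x [Gx|[? ? _ _ _]]]].
  + have [/GD[x Gx]|nD] := pselect (D c /\ D d); first by exists x; left.
    by have [//|x Ex Hx] := Htot (c, d); exists x; right.
  + have [Dc Dd] : D c /\ D d by apply/GD; exists x.
    by split; apply/domG'; right.
  + by split; apply/domG'.
Qed.

Lemma card_leX_infinite T U V (A : set T) (B : set U) (C : set V) :
  infinite_set C -> A #<= C -> B #<= C -> A `*` B #<= C.
Proof.
by move=> Cinf leAC leBC;
  exact: card_le_trans (card_leX leAC leBC) (card_le_square Cinf).
Qed.

Lemma card_le_bigcup K T U (D : set K) (F : K -> set T) (C : set U) :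
  infinite_set C -> D #<= C -> (forall k, D k -> F k #<= C) ->
  \bigcup_(k in D) F k #<= C.
Proof.
move=> Cinf DC FC.
apply: card_le_trans (card_leX_infinite Cinf DC (card_lexx C)).
have [k|G GP] := @choice _ _ (fun k (G : T -> U -> Prop) => D k ->
    (forall x, F k x -> exists2 c, C c & G x c) /\
    (forall x y c, F k x -> F k y -> G x c -> G y c -> x = y)).
  have [/FC/card_leE[G GP]|] := pselect (D k); first by exists G.
  by exists (fun _ _ => True).
apply: (@card_le_rel _ _ _ _ (fun x p => F p.1 x /\ G p.1 x p.2 /\ D p.1)).
  move=> x [k Dk Fkx]; have [Gtot _] := GP _ Dk.
  by have [c Cc Gc] := Gtot _ Fkx; exists (k, c).
move=> x y [k c] _ _ /= [Fx [Gx Dk]] [Fy [Gy _]].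
by have [_ Ginj] := GP _ Dk; exact: Ginj Gx Gy.
Qed.

(** Pairing codes sequences of a known length injectively; the length is added
    to the code. *)
Lemma card_le_seq T : infinite_set [set: T] -> [set: seq T] #<= [set: T].
Proof.
move=> Tinf.
have [pr _ prinj] : exists2 pr : T * T -> T, forall p, [set: T] (pr p) &
    injective pr.
  by apply: card_leT_fun; rewrite -setXTT; exact: card_le_square.
have [e einj _] := infinite_seq Tinf.
pose code := foldr (fun x y => pr (x, y)) (e 0%N).
apply: (@card_le_fun _ _ _ _ (fun s => pr (e (size s), code s))) => // s t _ _.
move=> /prinj[/einj]; elim: s t => [|x s IHs] [|y t] //= [st].
by move=> /prinj[->] /(IHs _ st) ->.
Qed.

Lemma finite_card_lt T U (A : set T) (B : set U) :
  finite_set A -> infinite_set B -> A #< B.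
Proof.
move=> Afin Binf; apply/card_ltNge => BA; apply: Binf.
exact: card_le_finite BA Afin.
Qed.

Lemma card_le_option T : infinite_set [set: T] ->
  [set: option T] #<= [set: T].
Proof.
move=> Tinf; apply: card_le_trans (card_le_double Tinf).
have [x0 _] := infinite_setN0 Tinf.
by apply: (@card_le_fun _ _ _ _ (fun o => (odflt x0 o, o : bool))) => [//|];
  move=> [x|] [y|] _ _ //= [->].
Qed.

(** * Well-orders, cardinals and regularity *)

Section wo.
Variables (T : eqType) (le : rel T).
Hypothesis le_wo : well_order le.

Let le_chain : wo_chain le predT.
Proof. by move=> A _; exact: le_wo. Qed.

Lemma wo_refl : reflexive le.
Proof. by move=> x; exact: (wo_chain_reflexive le_chain). Qed.

Lemma wo_total : total le.
Proof. by move=> x y; exact: (wo_chainW le_chain). Qed.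

Lemma wo_anti : antisymmetric le.
Proof. by move=> x y; exact: (wo_chain_antisymmetric le_chain). Qed.

Lemma wo_trans : transitive le.
Proof.
move=> y x z xy yz.
have [|m [[]]] := @le_wo (mem [:: x; y; z]); first by exists x; exact: mem_head.
rewrite /in_mem /= => /or4P[]// /eqP-> mP _.
- by apply: mP; rewrite /in_mem /= eqxx !orbT.
- have yx : le y x by apply: mP; rewrite /in_mem /= eqxx.
  by rewrite (@wo_anti x y) // xy yx.
- have zy : le z y by apply: mP; rewrite /in_mem /= eqxx orbT.
  by rewrite -(@wo_anti y z) // yz zy.
Qed.

Lemma wo_min (A : set T) : A !=set0 -> exists2 m, A m & forall x, A x -> le m x.
Proof.
move=> [a Aa]; have [|m [[mA mmin] _]] := @le_wo (mem A).
  by exists a; rewrite inE.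
exists m => [|x Ax]; first exact: set_mem.
by apply: mmin; rewrite inE.
Qed.

Lemma wo_ltNge x y : ~ le x y -> le y x /\ y <> x.
Proof.
by move=> nxy; have /orP[/nxy//|yx] := wo_total x y; split=> // yE;
  apply: nxy; rewrite yE wo_refl.
Qed.

End wo.

(** Well-order [A] and cut at the least point below which there are as many
    points as in all of [A], if there is such a point: the order is then
    initial. *)
Lemma cardinal_exists T (A : set T) :
  exists rho : cardinal, [set: rho] #= A.
Proof.
pose S : choiceType := {classic A}.
suff [rho rhoE] : exists rho : cardinal, [set: rho] #= [set: S].
  by exists rho; apply: card_eq_trans rhoE _; exact: card_setT.
have [le le_wo] := well_ordering_principle S.
have [big|small] := pselect
    (exists x, [set: S] #<= [set y | le y x /\ y <> x]); last first.
  suff init x : [set y | le y x /\ y <> x] #< [set: S].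
    by exists (Cardinal le_wo init).
  by apply/card_ltNge => bx; apply: small; exists x.
have [x xbig xmin] := wo_min le_wo big.
pose seg := {y : S | `[< le y x /\ y <> x >]}.
pose les : rel seg := fun u v => le (val u) (val v).
have les_wo : well_order les.
  apply: antisymmetric_well_order.
    by move=> u v /(wo_anti le_wo)/val_inj.
  move=> B [u uB].
  have [|v [w wB <-] vmin] := @wo_min _ _ le_wo [set val w | w in [set` B]].
    by exists (val u), u.
  by exists w; split=> // w' w'B; apply: vmin; exists w'.
have cseg : [set: seg] #= [set: S].
  rewrite card_eq_le; apply/andP; split.
    apply: (@card_le_fun _ _ _ _ val) => // u v _ _; exact: val_inj.
  apply: card_le_trans xbig _.
  apply: (@card_le_rel _ _ _ _ (fun y u => y = val u)).
    by move=> y /asboolP yx; exists (Sub y yx).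
  by move=> a b c _ _ -> ->.
suff init u : [set v | les v u /\ v <> u] #< [set: seg].
  by exists (Cardinal les_wo init).
apply/card_ltNge => bu.
have /asboolP[ux] := valP u; apply; apply: (wo_anti le_wo); rewrite ux /=.
apply: xmin; apply: card_le_trans (card_le_trans _ bu) _.
  by move: cseg; rewrite card_eq_le => /andP[].
apply: (@card_le_fun _ _ _ _ val) => [v [vu vDu]|v w _ _]; last exact: val_inj.
by split=> // /val_inj.
Qed.

Section cardinal_theory.
Variable mu : cardinal.
Implicit Types (x y z : mu) (B : set mu).

Lemma ordle_refl x : ordle x x. Proof. exact: (wo_refl (@ordle_wo mu)). Qed.

Lemma ordle_trans x y z : ordle x y -> ordle y z -> ordle x z.
Proof. exact: (wo_trans (@ordle_wo mu)). Qed.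

Lemma ordNle x y : ~ ordle x y -> ordlt y x.
Proof. exact: (wo_ltNge (@ordle_wo mu)). Qed.

Lemma ordltW x y : ordlt x y -> ordle x y. Proof. by case. Qed.

Lemma ordltNge x y : ordlt x y -> ~ ordle y x.
Proof.
move=> [xy xDy] yx; apply: xDy.
by apply: (wo_anti (@ordle_wo mu)); rewrite xy yx.
Qed.

Hypothesis mu_inf : infinite_set [set: mu].

(** With a maximum, the initial segment below it would already have the size of
    the whole infinite set. *)
Lemma ord_nomax x : exists y, ordlt x y.
Proof.
apply: contrapT => nlt; apply: mu_inf.
have xmax y : ordle y x.
  by apply: contrapT => /ordNle yx; apply: nlt; exists y.
have fin1 : finite_set [set x] by exact: finite_set1.
have [fin|inf] := pselect (finite_set [set y | ordle y x /\ y <> x]).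
  apply: (@sub_finite_set _ _ ([set y | ordle y x /\ y <> x] `|` [set x])).
    by move=> y _; have [->|yDx] := pselect (y = x); [right|left].
  by rewrite finite_setU.
have /card_ltNge[] := ordle_initial x.
have le1 : [set x] #<= [set y | ordle y x /\ y <> x].
  by have /orP[//|/card_le_finite/(_ fin1)] := card_le_total
    [set x] [set y | ordle y x /\ y <> x].
apply: card_le_trans (card_le_setU inf le1); apply: subset_card_le.
by move=> y _; have [->|yDx] := pselect (y = x); [left|right].
Qed.

Lemma ord_seg_lt x : [set y | ordle y x] #< [set: mu].
Proof.
have [z xz] := ord_nomax x.
apply: card_le_lt_trans (ordle_initial z); apply: subset_card_le => y yx.
split; first exact: ordle_trans yx (ordltW xz).
by move=> yz; apply: (ordltNge xz); rewrite -yz.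
Qed.

Definition regular :=
  forall B, B #< [set: mu] -> exists b, forall x, B x -> ordle x b.

Hypothesis mu_reg : regular.

(** Bounding each [F k] and then the bounds puts the union inside one initial
    segment. *)
Lemma regular_bigcup K (D : set K) (F : K -> set mu) :
  D #< [set: mu] -> (forall k, D k -> F k #< [set: mu]) ->
  \bigcup_(k in D) F k #< [set: mu].
Proof.
move=> Dmu Fmu.
have [x0 _] := infinite_setN0 mu_inf.
have [k|b bP] := @choice _ _ (fun k b => D k -> forall x, F k x -> ordle x b).
  by have [/Fmu/mu_reg[b]|] := pselect (D k); [exists b|exists x0].
have [c cP] : exists c, forall x, (b @` D) x -> ordle x c.
  by apply: mu_reg; apply: card_le_lt_trans Dmu; exact: card_image_le.
apply: card_le_lt_trans (ord_seg_lt c); apply: subset_card_le => x [k Dk Fkx].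
by apply: ordle_trans (bP _ Dk _ Fkx) (cP _ _); exists k.
Qed.

Lemma regular_pigeonhole T (D : set mu) (f : mu -> T) (E : set T) :
  E #< [set: mu] -> [set: mu] #<= D -> (forall x, D x -> E (f x)) ->
  exists t, [set: mu] #<= D `&` f @^-1` [set t].
Proof.
move=> Emu muD fE; apply: contrapT => small.
have /card_ltNge[] : D #< [set: mu]; last by [].
apply: (@card_le_lt_trans _ _ _ _
  (\bigcup_(t in E) (D `&` f @^-1` [set t]))).
  by apply: subset_card_le => x Dx; exists (f x) => //; exact: fE.
apply: regular_bigcup => // t _; apply/card_ltNge => big.
by apply: small; exists t.
Qed.

End cardinal_theory.

(** Let [A], of size [mu], be cofinal in [kappa]. By minimality of [mu], the
    elements of [A] with code at most [b] are bounded in [kappa], by [e b] say.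
    If [B] is unbounded in [mu], the values of [e] on [B] are therefore cofinal
    in [kappa], so [B] has size at least [mu]. *)
Lemma cofinality_regular (mu kappa : cardinal) : infinite_set [set: mu] ->
  is_cofinality mu kappa -> regular mu.
Proof.
move=> mu_inf [[A Acof]]; rewrite card_eq_le => /andP[Amu _] mumin B Bmu.
have [G [Gtot Ginj]] := card_leE Amu.
have [b|e eP] := @choice _ _ (fun (b : mu) (x : kappa) =>
    forall a c, A a -> ordle c b -> G a c -> ordle a x).
  pose Ab := [set a | A a /\ exists2 c, ordle c b & G a c].
  have Abmu : Ab #< [set: mu].
    apply: card_le_lt_trans (ord_seg_lt mu_inf b).
    apply: (@card_le_rel _ _ _ _ G) => [a [_ [c cb Gac]]|a a' c [Aa _] [Aa' _]].
      by exists c.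
    exact: Ginj.
  have [x xP] : exists x, forall a, Ab a -> ~ ordle x a.
    apply: contrapT => nx; have /card_ltNge[] := Abmu; apply: mumin => x.
    apply: contrapT => nax; apply: nx; exists x => a Aba xa.
    by apply: nax; exists a.
  exists x => a c Aa cb Gac; apply: ordltW; apply: ordNle.
  by apply: xP; split=> //; exists c.
apply: contrapT => unb; have /card_ltNge[] := Bmu.
apply: card_le_trans (card_image_le e B); apply: mumin => x.
have [a Aa xa] := Acof x; have [c _ Gac] := Gtot _ Aa.
have [b Bb cb] : exists2 b, B b & ordle c b.
  apply: contrapT => nb; apply: unb; exists c => b Bb.
  by apply: ordltW; apply: ordNle => cb; apply: nb; exists b.
exists (e b); first by exists b.
by apply: ordle_trans xa _; exact: eP Gac.
Qed.

(** The supremum is the least bound among cardinals, hence among all sets by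
    [cardinal_exists]. *)
Lemma sup_card_le I (nu : I -> cardinal) (kappa : cardinal) T (A : set T) :
  is_cardinal_sup nu kappa -> (forall i, [set: nu i] #<= A) ->
  [set: kappa] #<= A.
Proof.
move=> [_ ksup] nuA; have [rho] := cardinal_exists A.
rewrite card_eq_le => /andP[rhoA Arho].
apply: card_le_trans rhoA; apply: ksup => i; exact: card_le_trans (nuA i) Arho.
Qed.

(** * Compatible families of finite partial functions *)

Section compatible.
Variables (mu : cardinal) (T : eqType) (C : countType).
Hypothesis mu_uncountable : [set: nat] #< [set: mu].
Hypothesis mu_reg : regular mu.
Implicit Types (J D : set mu) (p : mu -> seq (T * C)).

(** A sequence of pairs encodes a finite partial function from [T] to [C]. *)
Definition functional (s : seq (T * C)) :=
  forall x c c', (x, c) \in s -> (x, c') \in s -> c = c'.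

Definition compatible p J := forall i j x c c', J i -> J j ->
  (x, c) \in p i -> (x, c') \in p j -> c = c'.

Let mu_inf : infinite_set [set: mu].
Proof. exact: infinite_card_le infinite_nat (card_ltW mu_uncountable). Qed.

(** This replaces the root and petals of the Delta-system lemma. If a point [x]
    lies in [mu] many domains, then [mu] many of the functions agree at [x]
    because [C] is countable, and removing [x] from them allows induction.
    Otherwise a maximal compatible family has size [mu]: a smaller one meets,
    by regularity, fewer than [mu] of the other domains, so one more function
    can be added. *)
Lemma compatible_of_size n p D : [set: mu] #<= D ->
  (forall i, D i -> size (p i) = n /\ functional (p i)) ->
  exists J, [/\ J `<=` D, [set: mu] #<= J & compatible p J].
Proof.
elim: n p D => [|n IHn] p D muD pP.
  exists D; split=> // i j x c c' /pP[/size0nil-> //].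
pose hit x := D `&` [set i | exists c, (x, c) \in p i].
have [[x muH]|light] := pselect (exists x, [set: mu] #<= hit x).
  have [i|v vP] := @choice _ _ (fun i c => hit x i -> (x, c) \in p i).
    have [[_ [c xc]]|nH] := pselect (hit x i); first by exists c.
    have [k [_ [c _]]] : hit x !=set0.
      by apply: infinite_setN0; exact: infinite_card_le muH.
    by exists c.
  have [||c muHc] := @regular_pigeonhole _ mu_inf mu_reg _ _ v [set: C] _ muH _.
  - exact: card_le_lt_trans (countableP _) mu_uncountable.
  - by [].
  have [|J [JH muJ Jcomp]] := IHn (fun i => rem (x, c) (p i)) _ muHc.
    move=> i [Hi vi]; have [Di _] := Hi; have [ps pf] := pP _ Di.
    have xc : (x, c) \in p i by rewrite -vi; exact: vP.
    split; first by rewrite size_rem // ps.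
    by move=> y d d' /mem_rem yd /mem_rem yd'; exact: pf yd yd'.
  exists J; split=> // [i /JH[[]]//|i j y d d' Ji Jj yd yd'].
  have memc k : J k -> (x, c) \in p k /\ functional (p k).
    by move=> /JH[Hk vk]; rewrite -vk; split;
      [exact: vP|have [/pP[]] := Hk].
  have [yx|/eqP yx] := pselect (y = x).
    rewrite yx in yd yd'; have [xi fi] := memc _ Ji; have [xj fj] := memc _ Jj.
    by rewrite (fi _ _ _ yd xi) (fj _ _ _ yd' xj).
  (* The only pair that [rem] drops is over [x]. *)
  have stay k e : (y, e) \in p k -> (y, e) \in rem (x, c) (p k).
    move=> ye; have := perm_to_rem; have [xk|xk] := boolP ((x, c) \in p k).
      move=> /(_ _ _ _ xk)/perm_mem/(_ (y, e)).
      rewrite ye inE => /esym/orP[|//].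
      by rewrite xpair_eqE (negPf yx).
    by move=> _; rewrite rem_id.
  exact: Jcomp Ji Jj (stay _ _ yd) (stay _ _ yd').
have [F FP Ftot|J [[JD Jcomp] Jmax]] :=
    @Zorn_bigcup _ [set J | J `<=` D /\ compatible p J].
  split=> [i [J /FP[JD _] /JD//]|i j x c c' [J FJ Ji] [K FK Kj]].
  have [JK|KJ] := Ftot _ _ FJ FK.
    by have [_ Kc] := FP _ FK; apply: Kc => //; exact: JK.
  by have [_ Jc] := FP _ FJ; apply: Jc => //; exact: KJ.
have [muJ|/card_ltNge Jmu] := pselect ([set: mu] #<= J); first by exists J.
pose U := \bigcup_(j in J) \bigcup_(x in [set` map fst (p j)]) hit x.
have Umu : U #< [set: mu].
  apply: (regular_bigcup mu_inf mu_reg) => // j _.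
  apply: (regular_bigcup mu_inf mu_reg) => [|x _].
    exact: finite_card_lt (finite_seq _) mu_inf.
  by apply/card_ltNge => xbig; apply: light; exists x.
have JUmu : J `|` U #< [set: mu] by exact: card_lt_setU.
have [i [Di nJi nUi]] : exists i, [/\ D i, ~ J i & ~ U i].
  apply: contrapT => no; have /card_ltNge[] := JUmu.
  apply: card_le_trans muD _; apply: subset_card_le => i Di.
  have [|nJi] := pselect (J i); first by left.
  by right; apply: contrapT => nUi; apply: no; exists i.
have apart j x c c' : J j -> (x, c) \in p j -> (x, c') \in p i -> False.
  move=> Jj xc xc'; apply: nUi; exists j => //; exists x; last first.
    by split=> //; exists c'.
  by rewrite /=; apply/mapP; exists (x, c).
exfalso; apply: (Jmax (J `|` [set i])).
  split=> [k|/(_ i)sub]; first by left.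
  by apply: nJi; apply: sub; right.
split=> [k [/JD//|->//]|k l x c c' [Jk|->] [Jl|->] xc xc'].
- exact: Jcomp xc xc'.
- by have := apart _ _ _ _ Jk xc xc'.
- by have := apart _ _ _ _ Jl xc' xc.
- by have [_ pf] := pP _ Di; exact: pf xc xc'.
Qed.

(** The form in which caliber [mu] of products of separable spaces is used: with
    countably many values, [mu] many of the finite partial functions have a
    common extension. *)
Lemma compatible_subfamily p : (forall i, functional (p i)) ->
  exists2 J, [set: mu] #<= J & compatible p J.
Proof.
move=> pf.
have [//|n mun] := @regular_pigeonhole _ mu_inf mu_reg _ _
  (fun i => size (p i)) [set: nat] mu_uncountable (card_lexx [set: mu]).
have [i [_ <-]|J [_ muJ Jc]] := @compatible_of_size n p _ mun; first by split.
by exists J.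
Qed.

End compatible.

(** * Continuous functions and the topology of pointwise convergence *)

Section Cp.
Variables (R : realType) (X : topologicalType).
Local Open Scope ring_scope.

(** A nonempty open set contains a nonempty basic one, given by finitely many
    points and a radius, and the centres can be moved to rationals: this leaves
    only countably many possible values. *)
Lemma Cp_open_rat (U : set (Cp R X)) (f : Cp R X) : open U -> U f ->
  exists (s : seq X) (g : X -> rat),
    forall h : Cp R X, (forall x, x \in s -> h x = ratr (g x)) -> U h.
Proof.
move=> [A oA <-] Af.
(* [F] consists of the sets that contain a basic neighbourhood of [f]; it
   converges to [f] pointwise, so it refines the neighbourhood filter. *)
pose F : set_system (X -> R) := [set B | exists (s : seq X) (e : R),
  0 < e /\ forall h : X -> R, (forall x, x \in s -> ball (f x) e (h x)) -> B h].
have FF : Filter F.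
  split; first by exists [::], 1.
  - move=> B B' [s [e [e0 sB]]] [s' [e' [e0' sB']]].
    exists (s ++ s'), (Num.min e e'); split; first by rewrite lt_min e0.
    have [me me'] : Num.min e e' <= e /\ Num.min e e' <= e'.
      by rewrite !ge_min !lexx orbT.
    move=> h hs; split; [apply: sB|apply: sB'] => x xs.
      by apply: (le_ball me); apply: hs; rewrite mem_cat xs.
    by apply: (le_ball me'); apply: hs; rewrite mem_cat xs orbT.
  - move=> B B' BB' [s [e [e0 sB]]]; exists s, e; split=> // h hs.
    by apply: BB'; exact: sB.
have Ff : F --> (f : {ptws X -> R}).
  apply/cvg_sup => x B [_ [[V oV <-] Vfx] VB].
  have /nbhs_ballP[e /= e0 eV] : nbhs ((f : X -> R) x) V.
    by apply: open_nbhs_nbhs.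
  exists [:: x], e; split=> // h hx; apply: VB; apply: eV.
  by apply: hx; exact: mem_head.
have [|s [e [e0 sA]]] := Ff A; first exact: open_nbhs_nbhs.
have [x|g gP] := @choice _ _ (fun x q => ball (f x) e (ratr q : R)).
  have [|q] := @rat_in_itvoo R (f x) (f x + e); first by rewrite ltrDl.
  rewrite in_itv /= => /andP[fq qfe]; exists q.
  by rewrite /ball /= ltr_distlC; lra.
by exists s, g => h hg; apply: sA => x xs; rewrite hg.
Qed.

Lemma Cp_open_eval (x : X) (V : set R) : open V ->
  open [set f : Cp R X | V (f x)].
Proof.
move=> oV; exists [set f : {ptws X -> R} | V (f x)] => //.
pose px : {ptws X -> R} -> R := proj x.
exact: (continuousP px).1 (@proj_continuous X (fun=> R) x) V oV.
Qed.

Lemma Cp_of_continuous (f : X -> R) : continuous f ->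
  exists h : Cp R X, forall x, h x = f x.
Proof.
move=> fc; pose fM := isContinuous.Build _ _ f fc.
pose h : continuousType X R := HB.pack f fM.
by exists h.
Qed.

End Cp.

Section lindelof_ext.
Variables (R : realType) (lam : infinite_cardinal) (theta : cardinal).
Local Notation L := (lindelof_ext lam theta).

Lemma lindelof_continuous (f : L -> R) (D : set L) : D #< [set: lam] ->
  (forall x, ~ D x -> f x = f None) -> continuous f.
Proof.
move=> Dlam fD; apply: (continuousP f).2 => V oV; rewrite lindelof_openE.
have [VN|] := pselect (V (f None)); [right|by left].
split=> //; apply: card_le_lt_trans Dlam; apply: subset_card_le => x nVx.
by apply: contrapT => /fD fx; apply: nVx; rewrite /= fx.
Qed.

Lemma lindelof_continuous_far (f : L -> R) (V : set R) : continuous f ->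
  open V -> V (f None) -> ~` (f @^-1` V) #< [set: lam].
Proof.
move=> fc oV VN; have := (continuousP f).1 fc V oV; rewrite lindelof_openE.
by case=> [nVN|[]//]; case: nVN.
Qed.

End lindelof_ext.

(** * Calibers *)

Section sums_of_cardinals.
Variables (R : realType) (kappa : cardinal) (lam : infinite_cardinal).
Variables (mu : cardinal) (kappa_ : mu -> cardinal).
Hypothesis mu_lt_lam : [set: mu] #< [set: lam].
Hypothesis lam_le : forall a, [set: lam] #<= [set: kappa_ a].
Hypothesis kappa_sup : is_cardinal_sup kappa_ kappa.

Let kappa_inf a : infinite_set [set: kappa_ a].
Proof. exact: infinite_card_le (@infinite_cardinalP lam) (lam_le a). Qed.

Section caliber.
Hypothesis mu_uncountable : [set: nat] #< [set: mu].
Hypothesis mu_reg : regular mu.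
Hypothesis kappa_mono : forall a b, ordle a b ->
  [set: kappa_ a] #<= [set: kappa_ b].
Hypothesis kappa_lt : forall a, [set: kappa_ a] #< [set: kappa].

(** If the fibres of [p] had size below a [kappa_ c] with [c] above [a] and [b],
    then [I] would be a union of at most [kappa_ c] sets of that size. *)
Lemma large_fibre I T (p : I -> T) a b : [set: I] #= [set: kappa] ->
  [set: T] #<= [set: kappa_ a] ->
  exists t, [set: kappa_ b] #<= [set i | p i = t].
Proof.
rewrite card_eq_le => /andP[_ kI] Ta.
have [c ac bc] : exists2 c, ordle a c & ordle b c.
  have [ab|/ordNle/ordltW ba] := pselect (ordle a b).
    by exists b => //; exact: ordle_refl.
  by exists a => //; exact: ordle_refl.
apply: contrapT => small; have /card_ltNge[] := kappa_lt c.
apply: card_le_trans kI _.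
apply: (@card_le_trans _ _ _ (\bigcup_(t in [set: T]) [set i | p i = t])).
  by apply: subset_card_le => i _; exists (p i).
apply: card_le_bigcup => // [|t _].
  exact: card_le_trans Ta (kappa_mono ac).
have /orP[//|big] := card_le_total [set i | p i = t] [set: kappa_ c].
by case: small; exists t; exact: card_le_trans (kappa_mono bc) big.
Qed.

(** Only [kappa_ a] finite prescriptions of rational values exist, so for every
    [b] one of them, [t b], forces a continuous function into [U i] for at least
    [kappa_ b] indices [i]. By [compatible_subfamily], [mu] many of
    the [t b] prescribe consistent values, and at fewer than [lam] points in
    total, so the function that is constant elsewhere is continuous. The
    indices [i] of these [t b] are [kappa] many. *)
Lemma caliber_Cp_lindelof_ext a :
  caliber kappa (Cp R (lindelof_ext lam (kappa_ a))).
Proof.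
pose L := lindelof_ext lam (kappa_ a).
move=> I U Ik oU.
have mu_inf : infinite_set [set: mu].
  exact: infinite_card_le infinite_nat (card_ltW mu_uncountable).
have [i|p pP] := @choice _ _ (fun i (s : seq (L * rat)) => [/\ functional s,
    exists c, (None, c) \in s &
    forall h : Cp R L, (forall x q, (x, q) \in s -> h x = ratr q) -> U i h]).
  have [oUi [f Uf]] := oU i; have [s [g sgU]] := Cp_open_rat oUi Uf.
  (* Prescribing the value at the added point as well makes all chosen functions
     agree on the constant used away from the prescribed points. *)
  exists [seq (x, g x) | x <- (None : L) :: s]; split.
  - by move=> x c c' /mapP[y _ [-> ->]] /mapP[z _ [-> ->]].
  - by exists (g None); exact: mem_head.
  - move=> h hs; apply: sgU => x xs; apply: hs.
    by apply/mapP; exists x => //; rewrite inE xs orbT.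
have cardS : [set: seq (L * rat)] #<= [set: kappa_ a].
  have LQ : [set: (L * rat)%type] #<= [set: kappa_ a].
    rewrite -setXTT; apply: card_leX_infinite => //.
      exact: card_le_option.
    by apply: card_le_trans (countableP [set: rat]) _; exact/infiniteP.
  apply: card_le_trans (card_le_seq _) LQ.
  have := @infinite_card_le _ _ [set: nat] [set: (L * rat)%type] infinite_nat.
  apply; apply: (@card_le_fun _ _ _ _
    (fun n => (None : L, n%:R%R : rat))) => //.
  by move=> n m _ _ [] /eqP; rewrite eqr_nat => /eqP.
have [b|t tP] := @choice _ _ (fun b t => [set: kappa_ b] #<= [set i | p i = t]).
  exact: large_fibre Ik cardS.
have tp b : exists i, p i = t b.
  by apply: infinite_setN0; exact: infinite_card_le (tP b).
have [b|J0 muJ0 J0c] := compatible_subfamily mu_uncountable mu_reg (p := t).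
  by have [i <-] := tp b; case: (pP i).
pose D : set L := \bigcup_(j in J0) [set` map fst (t j)].
have Dlam : D #< [set: lam].
  apply: card_le_lt_trans mu_lt_lam; apply: card_le_bigcup => //.
    exact: card_leT.
  move=> j _; apply: card_ltW; apply: finite_card_lt => //; exact: finite_seq.
have memD j x q : J0 j -> (x, q) \in t j -> D x.
  by move=> J0j xq; exists j => //=; apply/mapP; exists (x, q).
have [j0 J0j0] : J0 !=set0.
  by apply: infinite_setN0; exact: infinite_card_le muJ0.
have [c Nc] : exists c, (None, c) \in t j0.
  by have [i <-] := tp j0; case: (pP i).
have [x|F FP] := @choice _ _ (fun (x : L) (q : rat) =>
    (forall j r, J0 j -> (x, r) \in t j -> q = r) /\ (~ D x -> q = c)).
  have [[j J0j /mapP[[y q] xq /= yx]]|nDx] := pselect (D x).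
    exists q; split=> [k r J0k xr|nDx].
      by apply: J0c xr => //; [exact: J0j|rewrite yx].
    by case: nDx; rewrite yx; exact: memD xq.
  by exists c; split=> // j r J0j xr; case: nDx; exact: memD xr.
have Fc : continuous (fun x : L => ratr (F x) : R).
  apply: (lindelof_continuous Dlam) => x nDx.
  by rewrite (FP x).2 // ((FP None).1 j0 c).
have [h hF] := Cp_of_continuous Fc.
exists [set i | exists2 j, J0 j & p i = t j]; last first.
  exists h => i [j J0j pij]; have [_ _] := pP i; apply => x q.
  by rewrite pij hF => xq; rewrite ((FP x).1 j q).
rewrite card_eq_le; apply/andP; split.
  apply: card_le_trans (card_leT _) _.
  by move: Ik; rewrite card_eq_le => /andP[].
apply: (sup_card_le kappa_sup) => b.
have [j J0j bj] : exists2 j, J0 j & ordle b j.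
  apply: contrapT => nj; have /card_ltNge[] := ord_seg_lt mu_inf b.
  apply: card_le_trans muJ0 _; apply: subset_card_le => j J0j.
  by apply: ordltW; apply: ordNle => bj; apply: nj; exists j.
apply: card_le_trans (kappa_mono bj) _; apply: card_le_trans (tP j) _.
by apply: subset_card_le => i /= pij; exists j.
Qed.

End caliber.

(** For [i = (a, x)], let [U i] say that a function is near 2 at the isolated
    point [x] of the summand [a] and near 0 at its added point. A continuous
    function can do so for fewer than [lam] points of each of the [mu] summands,
    so it belongs to at most [lam] of these [kappa] sets. *)
Lemma not_caliber_Cp_sum : [set: lam] #< [set: kappa] ->
  ~ caliber kappa (Cp R {a : mu & lindelof_ext lam (kappa_ a)}).
Proof.
move=> lam_lt_kappa cal.
pose X : topologicalType := {a : mu & lindelof_ext lam (kappa_ a)}.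
pose I := {a : mu & kappa_ a}.
pose low : set R := (ball (0%R : R) 1%R)^°.
pose high : set R := (ball (2%R : R) 1%R)^°.
have low0 : low 0%R by exact: nbhsx_ballx.
have high2 : high 2%R by exact: nbhsx_ballx.
pose top (i : I) : X := existT _ (tag i) (Some (tagged i)).
pose infty a : X := existT _ a None.
pose U (i : I) : set (Cp R X) :=
  [set f | low (f (infty (tag i)))] `&` [set f | high (f (top i))].
have Ik : [set: I] #= [set: kappa].
  rewrite card_eq_le; apply/andP; split; last first.
    apply: (sup_card_le kappa_sup) => a.
    apply: (@card_le_fun _ _ _ _ (fun x : kappa_ a => existT _ a x : I)) => //.
    by move=> x y _ _ xy; exact: existT_inj2 xy.
  have kinf : infinite_set [set: kappa].
    exact: infinite_card_le (@infinite_cardinalP lam) (card_ltW lam_lt_kappa).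
  apply: (@card_le_trans _ _ _
    (\bigcup_(a in [set: mu]) [set i : I | tag i = a])).
    by apply: subset_card_le => i _; exists (tag i).
  apply: card_le_bigcup => // [|a _].
    exact: card_le_trans (card_ltW mu_lt_lam) (card_ltW lam_lt_kappa).
  apply: card_le_trans (kappa_sup.1 a).
  apply: (@card_le_rel _ _ _ _ (fun i (x : kappa_ a) => i = existT _ a x)).
    by move=> [b x] /= <-; exists x.
  by move=> i j x _ _ -> ->.
have oU i : open (U i) /\ U i !=set0.
  split.
    by apply: openI; apply: Cp_open_eval; exact: open_interior.
  pose f b (y : lindelof_ext lam (kappa_ b)) : R :=
    if existT _ b y == top i :> X then 2%R else 0%R.
  have topN b : (infty b == top i) = false.
    apply/eqP => bi; have ba : b = tag i := existT_inj1 bi.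
    by subst b; have := existT_inj2 bi.
  have fc b : continuous (f b).
    apply: (@lindelof_continuous _ _ _ _ [set y | existT _ b y = top i :> X]).
      apply: (@finite_card_lt _ _ _ _ _ (@infinite_cardinalP lam)).
      apply: (@card_le_finite _ _ _ [set: unit]); last exact: finite_finset.
      apply: (@card_le_fun _ _ _ _ (fun=> tt)) => // y z /= yi zi _.
      apply: (@existT_inj2 _ (fun a => lindelof_ext lam (kappa_ a)) b).
      by rewrite yi.
    by move=> y /eqP ny; rewrite /f (negPf ny) topN.
  have [h hf] := Cp_of_continuous (@sigT_continuous _ _ R f fc).
  have f0 : f (tag i) None = 0%R by rewrite /f topN.
  have f2 : f (tag i) (Some (tagged i)) = 2%R by rewrite /f eqxx.
  exists h; split.
    by move: low0; rewrite -f0 -[f _ _](hf (infty (tag i))).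
  by move: high2; rewrite -f2 -[f _ _](hf (top i)).
have [J Jk [f fJ]] := cal I U Ik oU.
have /card_ltNge[] := lam_lt_kappa.
move: Jk; rewrite card_eq_le => /andP[_ kJ]; apply: card_le_trans kJ _.
pose far a : set (lindelof_ext lam (kappa_ a)) :=
  ~` ((fun y => f (existT _ a y)) @^-1` low).
apply: (@card_le_trans _ _ _
  (\bigcup_(a in [set: mu]) (J `&` [set i : I | tag i = a]))).
  by apply: subset_card_le => i Ji; exists (tag i).
apply: card_le_bigcup; [exact: infinite_cardinalP|exact: card_ltW|move=> a _].
have [->|/set0P[j [Jj /= ja]]] := eqVneq (J `&` [set i : I | tag i = a]) set0.
  exact: card_ge0.
have farlam : far a #< [set: lam].
  apply: lindelof_continuous_far.
  - move=> y; apply: (@continuous_comp _ _ _ (existT _ a) f).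
      exact: existT_continuous.
    exact: cts_fun.
  - exact: open_interior.
  - by have [] := fJ _ Jj; rewrite -ja.
apply: card_le_trans (card_ltW farlam).
apply: (@card_le_rel _ _ _ _ (fun i y => top i = existT _ a y)).
  move=> [b x] [/= Ji ba]; subst b; exists (Some x) => //.
  rewrite /far /= => /interior_subset lo.
  have [_ /= /interior_subset] := fJ _ Ji; move: lo.
  by rewrite /ball /= !ltr_norml /top /=; lra.
move=> [b x] [c z] y [_ /= ba] [_ /= ca]; subst b c.
by rewrite /top /= => <- zx; case: (existT_inj2 zx) => ->.
Qed.

End sums_of_cardinals.

Theorem proposition8p12 (R : realType)
  (kappa : cardinal) (lam : infinite_cardinal)
  (cf_kappa cf_lam : cardinal)
  (cf_kappaP : is_cofinality cf_kappa kappa)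
  (cf_lamP : is_cofinality cf_lam lam)
  (lam_lt_kappa : [set: lam] #< [set: kappa])
  (cf_kappa_lt_lam : [set: cf_kappa] #< [set: lam])
  (omega_lt_cf_kappa : [set: omega] #< [set: cf_kappa])
  (omega_lt_cf_lam : [set: omega] #< [set: cf_lam])
  (kappa_ : cf_kappa -> cardinal)
  (lam_le_kappa0 : forall zero : cf_kappa, (forall a, ordle zero a) ->
    [set: lam] #<= [set: kappa_ zero])
  (kappa_incr : forall a b : cf_kappa, ordlt a b ->
    [set: kappa_ a] #< [set: kappa_ b])
  (kappa_sup : is_cardinal_sup kappa_ kappa) :
  (forall a : cf_kappa, caliber kappa (Cp R (lindelof_ext lam (kappa_ a)))) /\
  ~ caliber kappa (Cp R {a : cf_kappa & lindelof_ext lam (kappa_ a)}).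
Proof.
have cf_inf : infinite_set [set: cf_kappa].
  exact: infinite_card_le infinite_nat (card_ltW omega_lt_cf_kappa).
have kappa_mono a b : ordle a b -> [set: kappa_ a] #<= [set: kappa_ b].
  move=> ab; have [->|aDb] := pselect (a = b); first exact: card_lexx.
  by apply: card_ltW; exact: kappa_incr.
have kappa_lt a : [set: kappa_ a] #< [set: kappa].
  have [b ab] := ord_nomax cf_inf a.
  exact: card_lt_le_trans (kappa_incr _ _ ab) (kappa_sup.1 b).
have lam_le a : [set: lam] #<= [set: kappa_ a].
  have [zero _ zmin] := wo_min (@ordle_wo cf_kappa) (infinite_setN0 cf_inf).
  apply: card_le_trans (lam_le_kappa0 zero _) (kappa_mono _ _ _) => *;
    exact: zmin.
split=> [a|]; last exact: not_caliber_Cp_sum.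
by apply: caliber_Cp_lindelof_ext => //; exact: cofinality_regular cf_kappaP.
Qed.
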